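(* Let $f:\{0,1\}^n\to\{0,1\}$ and let $N_n$ be an NUOBDD computing $f$ that reads the variables in the order $\pi=(i_1,\dots,i_n)$. Then $$\mathrm{Width}(N_n)\ \ge\ \max_k |S^{\pi}_k|,$$ i.e. for every $k$ with $0<k<n$ and every strong 1-fooling set $S^{\pi}_k$ for $f$ with respect to $\pi$ and $k$, the width of $N_n$ is at least $|S^{\pi}_k|$.
   Context: A unitary OBDD (UOBDD) of width $d$ on variables $x_1,\dots,x_n$ is a quadruple $(Q,|\psi^0\rangle,T,Q_{acc})$, where $Q=\{q_1,\dots,q_d\}$ indexes an orthonormal basis $\{|q_1\rangle,\dots,|q_d\rangle\}$ of $\mathbb{C}^d$, $|\psi^0\rangle\in\mathbb{C}^d$ is a unit vector, $Q_{acc}\subseteq Q$, and $T=((i_j,U_j(0),U_j(1)))_{j=1}^n$ where $(i_1,\dots,i_n)$ is a permutation of $\{1,\dots,n\}$ (the order in which variables are read) and each $U_j(b)$ is a $d\times d$ unitary matrix. On input $\sigma\in\{0,1\}^n$ the final state is $|\psi^n\rangle=U_n(\sigma_{i_n})\cdots U_1(\sigma_{i_1})|\psi^0\rangle$ and the acceptance probability is $\|P_{acc}|\psi^n\rangle\|^2$, where $P_{acc}$ is the orthogonal projection onto the span of $\{|q\rangle: q\in Q_{acc}\}$. A nondeterministic UOBDD (NUOBDD) is a UOBDD used with threshold 0: it computes $f$ if for every $\sigma$, $f(\sigma)=1$ iff $\sigma$ is accepted with nonzero probability. The width is $d$. For a permutation $\pi=(i_1,\dots,i_n)$ and $0<k<n$,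 for $\sigma\in\{0,1\}^k$ and $\gamma\in\{0,1\}^{n-k}$ write $f|_{\rho^{\sigma}_{\pi,k}}(\gamma)$ for the value of $f$ on the input that assigns $x_{i_1},\dots,x_{i_k}$ the bits of $\sigma$ and $x_{i_{k+1}},\dots,x_{i_n}$ the bits of $\gamma$. A set $S^{\pi}_k\subseteq\{0,1\}^k\times\{0,1\}^{n-k}$ is a strong 1-fooling set for $f$ if $f|_{\rho^{\sigma}_{\pi,k}}(\gamma)=1$ for every $(\sigma,\gamma)\in S^{\pi}_k$, and for any two distinct pairs $(\sigma,\gamma),(\sigma',\gamma')\in S^{\pi}_k$ we have $f|_{\rho^{\sigma}_{\pi,k}}(\gamma')=0$ and $f|_{\rho^{\sigma'}_{\pi,k}}(\gamma)=0$. *)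

(* Defs.v *)
From mathcomp Require Import all_boot all_order fingroup perm all_algebra.

Set Implicit Arguments.
Unset Strict Implicit.
Unset Printing Implicit Defensive.

Import Order.TTheory GRing.Theory Num.Theory.

Local Open Scope ring_scope.
Local Open Scope sesquilinear_scope.

Definition inner (C : numClosedFieldType) (d : nat) (u v : 'cV[C]_d) : C :=
  (u ^t* *m v) 0 0.

Definition sqnorm (C : numClosedFieldType) (d : nat) (v : 'cV[C]_d) : C :=
  \sum_(i < d) `|v i 0| ^+ 2.

(* Unitary OBDDs on n variables. Indices start at 0: the j-th variable read   *)
(* is the one of index [read_order j]. The states Q are the elements of       *)
(* ['I_width]; the [width] orthonormal vectors [ket q] form a basis of the    *)
(* [width]-dimensional space.                                                 *)
Record uobdd (C : numClosedFieldType) (n : nat) := Uobdd {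
  width : nat;
  ket : 'I_width -> 'cV[C]_width;
  ket_orthonormal : forall p q : 'I_width, inner (ket p) (ket q) = (p == q)%:R;
  init_state : 'cV[C]_width;
  init_state_unit : sqnorm init_state = 1;
  read_order : 'S_n;
  trans : 'I_n -> bool -> 'M[C]_width;
  trans_unitary : forall (j : 'I_n) (b : bool), trans j b \is unitarymx;
  acc_states : {set 'I_width}
}.

Arguments ket {C n} u q.
Arguments trans {C n} u j b.

Section Semantics.
Variables (C : numClosedFieldType) (n : nat).
Implicit Types (N : uobdd C n) (x : n.-tuple bool).

(* [enum 'I_n] is increasing, so this is U_n(..) ... U_1(..) |psi^0>. *)
Definition final_state N x : 'cV[C]_(width N) :=
  foldl (fun psi j => trans N j (tnth x (read_order N j)) *m psi) (init_state N)
    (enum 'I_n).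

Definition acc_proj N : 'M[C]_(width N) :=
  \sum_(q in acc_states N) ket N q *m (ket N q) ^t*.

Definition acc_prob N x : C := sqnorm (acc_proj N *m final_state N x).

Definition nondet_computes N (f : n.-tuple bool -> bool) : Prop :=
  forall x, f x = true <-> acc_prob N x <> 0.

End Semantics.

(* The variable of index [pi j] receives the j-th bit of [sigma ++ gamma];    *)
(* the default value of [nth] is never reached when k <= n.                   *)
Definition assign (n : nat) (pi : 'S_n) (k : nat)
    (sigma : k.-tuple bool) (gamma : (n - k).-tuple bool) : n.-tuple bool :=
  [tuple nth false (sigma ++ gamma) ((pi^-1)%g i) | i < n].

Lemma tnth_assign (n : nat) (pi : 'S_n) (k : nat)
    (sigma : k.-tuple bool) (gamma : (n - k).-tuple bool) (j : 'I_n) :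
  tnth (assign pi sigma gamma) (pi j) = nth false (sigma ++ gamma) j.
Proof. by rewrite tnth_mktuple permK. Qed.

Definition restriction (n : nat) (f : n.-tuple bool -> bool) (pi : 'S_n)
    (k : nat) (sigma : k.-tuple bool) : (n - k).-tuple bool -> bool :=
  fun gamma => f (assign pi sigma gamma).

Definition strong_1_fooling_set (n : nat) (f : n.-tuple bool -> bool)
    (pi : 'S_n) (k : nat) (S : {set k.-tuple bool * (n - k).-tuple bool}) :
    Prop :=
  (forall (sigma : k.-tuple bool) (gamma : (n - k).-tuple bool),
     (sigma, gamma) \in S -> restriction f pi sigma gamma = true) /\
  (forall (sigma sigma' : k.-tuple bool) (gamma gamma' : (n - k).-tuple bool),
     (sigma, gamma) \in S -> (sigma', gamma') \in S ->
     (sigma, gamma) <> (sigma', gamma') ->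
     restriction f pi sigma gamma' = false /\
     restriction f pi sigma' gamma = false).

(* Main.v *)
(** Cut the computation after [k] steps: on the input [assign pi sigma gamma]
    the projected final state is a matrix depending on [gamma] only, applied to
    a vector depending on [sigma] only. Along a strong 1-fooling set the matrix
    attached to one pair kills the vector of every other pair but not the
    vector of its own pair, so these vectors are linearly independent in a
    space whose dimension is the width. *)
Require Import Defs.
From mathcomp Require Import all_boot all_order fingroup perm all_algebra.
From mathcomp Require Import reals.
From mathcomp.real_closed Require Import complex.

Set Implicit Arguments.
Unset Strict Implicit.
Unset Printing Implicit Defensive.

Import Order.TTheory GRing.Theory Num.Theory.

Local Open Scope ring_scope.
Local Open Scope complex_scope.

(** In a vanishing combination of the [v t], applying [A s] leaves only the term of [s], whose
    coefficient must then be 0. The values of [A] are matrices, not linear forms, because acceptance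
    is tested by a projection of arbitrary rank. *)
Lemma card_biorthogonal (F : fieldType) (T : finType) (S : {set T}) (m d : nat)
    (A : T -> 'M[F]_(m, d)) (v : T -> 'cV[F]_d) :
  {in S, forall s, A s *m v s != 0} ->
  {in S &, forall s t, s != t -> A s *m v t = 0} ->
  (#|S| <= d)%N.
Proof.
move=> Avs Avt.
pose M : 'M_(d, #|S|) := \matrix_(i, j) v (enum_val j) i 0.
(* The vectors are the columns of [M], so their independence is freeness of the rows of [M^T], whose
   rank is at most its [d] columns. *)
suff freeM : row_free M^T by rewrite -(eqP freeM) rank_leq_col.
apply/inj_row_free => u uM0.
have {}uM0 : M *m u^T = 0 by rewrite -[M]trmxK -trmx_mul uM0 trmx0.
have Mu : M *m u^T = \sum_j u 0 j *: v (enum_val j).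
  apply/colP => i; rewrite mxE summxE; apply: eq_bigr => j _.
  by rewrite !mxE mulrC.
apply/rowP => i; rewrite [RHS]mxE.
have := congr1 (mulmx (A (enum_val i))) uM0.
rewrite Mu mulmx0 mulmx_sumr (bigD1 i) //= big1 ?addr0 => [|j jNi].
  rewrite -scalemxAr => /eqP; rewrite scaler_eq0.
  by rewrite (negPf (Avs _ (enum_valP i))) orbF => /eqP.
rewrite -scalemxAr Avt ?scaler0 ?enum_valP //.
by rewrite (inj_eq enum_val_inj) eq_sym.
Qed.

Lemma sqnorm_eq0 (C : numClosedFieldType) (d : nat) (v : 'cV[C]_d) :
  (sqnorm v == 0) = (v == 0).
Proof.
rewrite /sqnorm psumr_eq0; last by move=> i _; apply: exprn_ge0.
apply/allP/eqP => [v0 | -> i _]; last by rewrite mxE normr0 expr0n /=.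
apply/colP => i; apply/eqP; rewrite [X in _ == X]mxE.
by have := v0 i (mem_index_enum i); rewrite sqrf_eq0 normr_eq0.
Qed.

Section Runs.
Variables (C : numClosedFieldType) (n : nat) (N : uobdd C n).
Implicit Types (x y : n.-tuple bool) (s : seq 'I_n).

Definition run x s : 'M[C]_(width N) :=
  foldl (fun U j => trans N j (tnth x (read_order N j)) *m U) 1%:M s.

Lemma foldl_run x s (psi : 'cV[C]_(width N)) :
  foldl (fun phi j => trans N j (tnth x (read_order N j)) *m phi) psi s =
  run x s *m psi.
Proof.
(* Induction from the right end: the last variable read contributes the outermost, leftmost
   factor. *)
rewrite /run; elim/last_ind: s => [|s j IHs]; first by rewrite mul1mx.
by rewrite !foldl_rcons IHs mulmxA.
Qed.

Lemma run_cat x s1 s2 : run x (s1 ++ s2) = run x s2 *m run x s1.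
Proof.
rewrite /run; elim/last_ind: s2 => [|s2 j IHs]; first by rewrite cats0 mul1mx.
by rewrite -rcons_cat !foldl_rcons IHs mulmxA.
Qed.

(** This allows the input to be changed freely on the other side of the cut. *)
Lemma eq_run x y s :
  {in s, forall j, tnth x (read_order N j) = tnth y (read_order N j)} ->
  run x s = run y s.
Proof.
rewrite /run; elim/last_ind: s => [//|s j IHs] eqxy.
rewrite !foldl_rcons eqxy ?mem_rcons ?mem_head // IHs // => i si.
by rewrite eqxy // mem_rcons inE si orbT.
Qed.

Lemma final_state_cut k x :
  final_state N x =
  run x (drop k (enum 'I_n)) *m (run x (take k (enum 'I_n)) *m init_state N).
Proof. by rewrite mulmxA -run_cat cat_take_drop -foldl_run. Qed.

End Runs.

Lemma mem_take_enum_ord (n k : nat) (j : 'I_n) :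
  j \in take k (enum 'I_n) -> (j < k)%N.
Proof.
move=> /(map_f val); rewrite map_take val_enum_ord take_iota mem_iota.
by rewrite leq_min => /andP[_ /andP[]].
Qed.

Lemma mem_drop_enum_ord (n k : nat) (j : 'I_n) :
  j \in drop k (enum 'I_n) -> (k <= j)%N.
Proof.
by move=> /(map_f val); rewrite map_drop val_enum_ord drop_iota mem_iota => /andP[].
Qed.

Lemma card_fooling_set_le_width (C : numClosedFieldType) (n : nat)
    (f : n.-tuple bool -> bool)
    (N : uobdd C n) (pi : 'S_n)
    (hf : nondet_computes N f) (hpi : read_order N = pi)
    (k : nat)
    (S : {set k.-tuple bool * (n - k).-tuple bool})
    (hS : strong_1_fooling_set f pi S) :
  (#|S| <= width N)%N.
Proof.
case: hS => S1 S0.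
pose input (p : k.-tuple bool * (n - k).-tuple bool) := assign pi p.1 p.2.
pose A p := acc_proj N *m run N (input p) (drop k (enum 'I_n)).
pose v p := run N (input p) (take k (enum 'I_n)) *m init_state N.
(* Before the cut only [q.1] is read, after it only [p.2]; hence both factors can be computed on the
   one mixed input. *)
have AvE p q : A p *m v q = acc_proj N *m final_state N (assign pi q.1 p.2).
  have runA : run N (input p) (drop k (enum 'I_n)) =
              run N (assign pi q.1 p.2) (drop k (enum 'I_n)).
    apply: eq_run => j /mem_drop_enum_ord kj.
    by rewrite hpi !tnth_assign !nth_cat !size_tuple ltnNge kj.
  have runv : run N (input q) (take k (enum 'I_n)) =
              run N (assign pi q.1 p.2) (take k (enum 'I_n)).
    apply: eq_run => j /mem_take_enum_ord jk.
    by rewrite hpi !tnth_assign !nth_cat !size_tuple jk.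
  by rewrite /A /v runA runv (final_state_cut N k) -mulmxA.
(* Threshold 0 turns acceptance into the projected final state being nonzero. *)
have fE p q : restriction f pi q.1 p.2 = (A p *m v q != 0).
  rewrite AvE -sqnorm_eq0 -/(acc_prob N _) /restriction.
  by apply/idP/idP => [/hf/eqP | /eqP/hf].
apply: (@card_biorthogonal _ _ S _ _ A v) => [[s g] sgS | p q pS qS pNq].
  by rewrite -fE S1.
(* The mixed input takes its prefix from [q] and its suffix from [p], so the second half of the
   fooling condition applies. *)
apply/eqP/negbFE; rewrite -fE.
case: p q pS qS pNq => [s g] [s' g'] pS qS /eqP pNq.
by case: (S0 _ _ _ _ pS qS pNq).
Qed.

Theorem theorem1 (R : realType) (n : nat) (f : n.-tuple bool -> bool)
    (N : uobdd R[i] n) (pi : 'S_n)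
    (hf : nondet_computes N f) (hpi : read_order N = pi)
    (k : nat) (hk : (0 < k < n)%N)
    (S : {set k.-tuple bool * (n - k).-tuple bool})
    (hS : strong_1_fooling_set f pi S) :
  (#|S| <= width N)%N.
Proof. exact (card_fooling_set_le_width hf hpi hS). Qed.
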